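(* Let $(\mathcal{A},\partial)$ be a super-commutative DGA over a field $\mathbf{k}$ for which either: (1) $\operatorname{char}\mathbf{k}\neq 2$, and the grading is taken in the group $\mathbb{Z}/2\mathbb{Z}$; or (2) $\operatorname{char}\mathbf{k}=2$, and the grading is arbitrary (i.e. in $\mathbb{Z}/\mu\mathbb{Z}$ for any integer $\mu$). Then there exists an augmentation of $(\mathcal{A},\partial)$ into some field $\mathbb{F}\supset\mathbf{k}$, i.e. a unital DGA morphism $\varepsilon:(\mathcal{A},\partial)\to(\mathbb{F},0)$, if and only if $(\mathcal{A},\partial)$ is not acyclic.
   Context: A super-commutative DGA over $\mathbf{k}$ is a pair $(\mathcal{A},\partial)$ as follows. $\mathcal{A}$ is the quotient of the free associative unital $\mathbf{k}$-algebra on finitely many generators $a_1,\dots,a_m$, with degrees $|a_i|\in\mathbb{Z}/\mu\mathbb{Z}$, by the relations $a\cdot b=(-1)^{|a||b|}\,b\cdot a$ for homogeneous $a,b$ (in particular, odd elements square to zero if $\operatorname{char}\mathbf{k}\ne2$; if $\operatorname{char}\mathbf{k}=2$, $\mathcal{A}$ is the polynomial algebra). The degree of a monomial is the sum of the degrees of its factors, and scalars have degree $0$. The map $\partial:\mathcal{A}\to\mathcal{A}$ is $\mathbf{k}$-linear of degree $-1$, with $\partial^2=0$, $\partial|_{\mathbf{k}}=0$ and $\partial(\mathbf{a}\mathbf{b})=\partial(\mathbf{a})\mathbf{b}+(-1)^{|\mathbf{a}|}\mathbf{a}\,\partial(\mathbf{b})$ for monomials $\mathbf{a},\mathbf{b}$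 (signs are immaterial in characteristic two). Each generator also has an action $\ell(a_i)\in\mathbb{R}_{>0}$, extended additively to monomials with $\ell(r)=0$ for $r\in\mathbf{k}\setminus\{0\}$, such that every monomial appearing in $\partial(a_i)$ with a non-zero coefficient has action strictly less than $\ell(a_i)$. Acyclic means $\ker\partial/\operatorname{im}\partial=0$. $(\mathbb{F},0)$ is the field $\mathbb{F}$ regarded as a unital DGA with empty generating set and zero differential. A unital DGA morphism $\varepsilon:(\mathcal{A},\partial)\to(\mathbb{F},0)$ is here a unital $\mathbf{k}$-algebra homomorphism $\varepsilon:\mathcal{A}\to\mathbb{F}$ with $\varepsilon\circ\partial=0$ (equivalently, a unital $\mathbf{k}$-algebra homomorphism from $\mathcal{A}/\mathcal{A}\partial(\mathcal{A})\mathcal{A}$ to $\mathbb{F}$, where $\mathcal{A}\partial(\mathcal{A})\mathcal{A}$ is the two-sided ideal generated by the boundaries); it is not required to preserve the grading. *)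

(* Defs.v *)
From HB Require Import structures.
From mathcomp Require Import all_boot all_order all_algebra.
From mathcomp Require Import boolp reals.
From mathcomp.multinomials Require Import monalg.

Set Implicit Arguments.
Unset Strict Implicit.
Unset Printing Implicit Defensive.

Import Order.TTheory GRing.Theory Num.Theory.
Local Open Scope ring_scope.
Local Open Scope quotient_scope.

Inductive two_sided_gen (B : nzRingType) (S : B -> Prop) : B -> Prop :=
| two_sided_gen_base p of S p : two_sided_gen S p
| two_sided_gen0 : two_sided_gen S 0
| two_sided_genD p q of two_sided_gen S p & two_sided_gen S q : two_sided_gen S (p + q)
| two_sided_genMl p q of two_sided_gen S q : two_sided_gen S (p * q)
| two_sided_genMr p q of two_sided_gen S p : two_sided_gen S (p * q).

(* Z/mu is handled through integer representatives of its elements, compared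
   modulo mu; mu = 0 gives Z and mu = 1 the trivial group. *)
Section SuperAlgebra.
Variables (k : fieldType) (mu : int) (n : nat) (deg : 'I_n -> int).

Definition freealg : Type := {malg k[{fmonom 'I_n}]}.
HB.instance Definition _ := GRing.Lalgebra.copy freealg {malg k[{fmonom 'I_n}]}.

Implicit Types (w : {fmonom 'I_n}) (d e : int).

Definition word_deg w : int := \sum_(i <- (w : seq 'I_n)) deg i.

Definition free_homog d (p : freealg) : Prop :=
  forall w, p@_w != 0 -> (word_deg w = d %[mod mu])%Z.

(* Exponents are reduced modulo mu so that signs only depend on classes in Z/mu.
   When mu is even or k has characteristic 2, parity_sign d = (-1)^d and
   koszul d e = (-1)^(de). *)
Definition parity_sign d : k := (-1) ^ (d %% mu)%Z.

Definition koszul d e : k := (-1) ^ ((d %% mu)%Z * (e %% mu)%Z).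

Definition supercomm_rel (p : freealg) : Prop :=
  exists d e (a b : freealg),
    [/\ free_homog d a, free_homog e b & p = a * b - koszul d e *: (b * a)].

Definition supercomm_ideal : {pred freealg} :=
  fun p => `[< two_sided_gen supercomm_rel p >].

Lemma supercomm_idealP (p : freealg) :
  reflect (two_sided_gen supercomm_rel p) (p \in supercomm_ideal).
Proof. exact: asboolP. Qed.

Lemma supercomm_ideal_zmod : zmod_closed supercomm_ideal.
Proof.
split=> [|p q /supercomm_idealP Ip /supercomm_idealP Iq]; apply/supercomm_idealP.
  exact: two_sided_gen0.
by rewrite -mulN1r; apply: two_sided_genD => //; apply: two_sided_genMl.
Qed.

HB.instance Definition _ :=
  GRing.isZmodClosed.Build freealg supercomm_ideal supercomm_ideal_zmod.

Lemma supercomm_idealMl (p q : freealg) :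
  q \in supercomm_ideal -> p * q \in supercomm_ideal.
Proof. by move=> /supercomm_idealP ?; apply/supercomm_idealP/two_sided_genMl. Qed.

Lemma supercomm_idealMr (p q : freealg) :
  p \in supercomm_ideal -> p * q \in supercomm_ideal.
Proof. by move=> /supercomm_idealP ?; apply/supercomm_idealP/two_sided_genMr. Qed.

Lemma word_deg1 : word_deg mone = 0.
Proof. by rewrite /word_deg fm1 big_nil. Qed.

Lemma supercomm_ideal1 : 1 \notin supercomm_ideal.
Proof.
pose c (p : freealg) : k := p@_mone.
have cM p q : c (p * q) = c p * c q by exact: rmorphM.
suff I0 p : two_sided_gen supercomm_rel p -> c p = 0.
  apply/supercomm_idealP => /I0/eqP; rewrite /c rmorph1.
  by rewrite oner_eq0.
elim=> {p} [_ [d [e [a [b [ha hb ->]]]]]||p q _ Ip _ Iq|p q _ Iq|p q _ Ip].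
- rewrite {1}/c mcoeffB mcoeffZ -/(c (a * b)) -/(c (b * a)) !cM.
  have [->|a1] := eqVneq (c a) 0; first by rewrite !(mul0r, mulr0) subrr.
  have := ha _ a1; rewrite word_deg1 mod0z => d0.
  by rewrite /koszul -d0 mul0r expr0z mul1r mulrC subrr.
- exact: mcoeff0.
- by rewrite /c mcoeffD -/(c p) -/(c q) Ip Iq addr0.
- by rewrite cM Iq mulr0.
- by rewrite cM Ip mul0r.
Qed.

Definition superalg : Type := Quotient.quot supercomm_ideal.
HB.instance Definition _ := Choice.on superalg.
HB.instance Definition _ := EqQuotient.on superalg.
HB.instance Definition _ := GRing.Zmodule.on superalg.

Local Notation pi := (\pi_superalg).

Lemma pi_eq (p q : freealg) : (pi p == pi q) = (p - q \in supercomm_ideal).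
Proof. by rewrite -Quotient.idealrBE. Qed.

Lemma pi_addE (p q : freealg) : pi (p + q) = pi p + pi q.
Proof. exact: (@pi_addr _ _ _ _ _ (Quotient.quot supercomm_ideal)). Qed.

Lemma repr_pi (p : freealg) : p - repr (pi p) \in supercomm_ideal.
Proof. by rewrite -pi_eq reprK. Qed.

Definition superalg_one : superalg := pi 1.
Definition superalg_mul : superalg -> superalg -> superalg :=
  lift_op2 superalg (fun p q : freealg => p * q).
Definition superalg_scale (c : k) : superalg -> superalg :=
  lift_op1 superalg (fun p : freealg => c *: p).

Lemma pi_mulE (p q : freealg) : pi (p * q) = superalg_mul (pi p) (pi q).
Proof.
unlock superalg_mul; apply/eqP; rewrite pi_eq.
set p' := repr (pi p); set q' := repr (pi q).
have -> : p * q - p' * q' = (p - p') * q + p' * (q - q').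
  by rewrite mulrBl mulrBr addrA subrK.
by apply: rpredD; [apply: supercomm_idealMr | apply: supercomm_idealMl];
  exact: repr_pi.
Qed.

Lemma pi_scaleE c (p : freealg) : pi (c *: p) = superalg_scale c (pi p).
Proof.
unlock superalg_scale; apply/eqP; rewrite pi_eq -scalerBr -[_ - _]mul1r scalerAl.
by apply: supercomm_idealMl; exact: repr_pi.
Qed.

Lemma superalg_mulA : associative superalg_mul.
Proof.
by move=> x y z; rewrite -[x]reprK -[y]reprK -[z]reprK -!pi_mulE mulrA.
Qed.

Lemma superalg_mul1 : left_id superalg_one superalg_mul.
Proof. by move=> x; rewrite -[x]reprK -pi_mulE mul1r. Qed.

Lemma superalg_mulr1 : right_id superalg_one superalg_mul.
Proof. by move=> x; rewrite -[x]reprK -pi_mulE mulr1. Qed.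

Lemma superalg_mulDl : left_distributive superalg_mul +%R.
Proof.
move=> x y z; rewrite -[x]reprK -[y]reprK -[z]reprK.
by rewrite -pi_addE -!pi_mulE -pi_addE mulrDl.
Qed.

Lemma superalg_mulDr : right_distributive superalg_mul +%R.
Proof.
move=> x y z; rewrite -[x]reprK -[y]reprK -[z]reprK.
by rewrite -pi_addE -!pi_mulE -pi_addE mulrDr.
Qed.

Lemma superalg_one_neq0 : superalg_one != 0.
Proof.
have -> : 0 = pi 0.
  by rewrite [RHS](@pi_zeror _ _ _ _ _ (Quotient.quot supercomm_ideal)).
by rewrite pi_eq subr0 supercomm_ideal1.
Qed.

HB.instance Definition _ := GRing.Zmodule_isNzRing.Build superalg
  superalg_mulA superalg_mul1 superalg_mulr1 superalg_mulDl superalg_mulDr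
  superalg_one_neq0.

Lemma superalg_scaleA a b x :
  superalg_scale a (superalg_scale b x) = superalg_scale (a * b) x.
Proof. by rewrite -[x]reprK -!pi_scaleE scalerA. Qed.

Lemma superalg_scale1 : left_id 1 superalg_scale.
Proof. by move=> x; rewrite -[x]reprK -pi_scaleE scale1r. Qed.

Lemma superalg_scaleDr : right_distributive superalg_scale +%R.
Proof.
move=> a x y; rewrite -[x]reprK -[y]reprK.
by rewrite -pi_addE -!pi_scaleE -pi_addE scalerDr.
Qed.

Lemma superalg_scaleDl x : {morph superalg_scale^~ x : a b / a + b}.
Proof.
by move=> a b; rewrite -[x]reprK /= -!pi_scaleE -pi_addE scalerDl.
Qed.

HB.instance Definition _ := GRing.Zmodule_isLmodule.Build k superalg
  superalg_scaleA superalg_scale1 superalg_scaleDr superalg_scaleDl.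

Lemma superalg_scaleAl (a : k) (x y : superalg) : a *: (x * y) = a *: x * y.
Proof.
rewrite -[x]reprK -[y]reprK.
rewrite -[LHS]/(superalg_scale a (superalg_mul _ _)).
rewrite -[RHS]/(superalg_mul (superalg_scale _ _) _).
by rewrite -pi_scaleE -!pi_mulE -pi_scaleE scalerAl.
Qed.

HB.instance Definition _ :=
  GRing.Lmodule_isLalgebra.Build k superalg superalg_scaleAl.

Lemma superalg_scaleAr (a : k) (x y : superalg) : a *: (x * y) = x * (a *: y).
Proof.
rewrite -[x]reprK -[y]reprK.
rewrite -[LHS]/(superalg_scale a (superalg_mul _ _)).
rewrite -[RHS]/(superalg_mul _ (superalg_scale _ _)).
rewrite -pi_scaleE -!pi_mulE -pi_scaleE; congr (pi _).
set p : freealg := repr x; set q : freealg := repr y.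
apply/malgP => w; rewrite mcoeffZ.
rewrite (mcoeffMlw w (finmap.fsubset_refl _) (finmap.fsubset_refl (msupp q))).
rewrite (mcoeffMlw w (finmap.fsubset_refl _) (msuppZ_le a q)).
rewrite mulr_sumr; apply: eq_bigr => u _; rewrite mulr_sumr.
by apply: eq_bigr => v _; rewrite mcoeffZ mulrnAr mulrCA.
Qed.

HB.instance Definition _ :=
  GRing.Lalgebra_isAlgebra.Build k superalg superalg_scaleAr.

Definition homog d (x : superalg) : Prop :=
  exists2 p : freealg, x = pi p & free_homog d p.

Definition monom w : superalg := pi << w >>.

(* When mu is even or k has characteristic 2, the normal words map to a basis of
   the algebra, so that the coefficient of a monomial in an element makes sense:
   generators come in increasing order, those with sign -1 <> 1 against themselves
   (odd, in characteristic not 2) occurring at most once. *)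
Definition normal_word w : bool :=
  sorted (fun i j : 'I_n =>
    (i < j)%N || (i == j) && (koszul (deg i) (deg i) == 1)) w.

Definition appears w (x : superalg) : Prop :=
  exists p : freealg,
    [/\ x = pi p, forall u, p@_u != 0 -> normal_word u & p@_w != 0].

End SuperAlgebra.

Record superDGA (R : realType) (k : fieldType) (mu : int) := SuperDGA {
  ngen : nat;
  gen_deg : 'I_ngen -> int;
  diff : {linear superalg k mu gen_deg -> superalg k mu gen_deg};
  action : 'I_ngen -> R;
  diff_homog : forall (d : int) x,
    homog d x -> homog (d - 1) (diff x);
  diff_square : forall x, diff (diff x) = 0;
  diff_scalar : forall c : k, diff c%:A = 0;
  diff_leibniz : forall u v : {fmonom 'I_ngen},
    diff (monom k mu gen_deg u * monom k mu gen_deg v)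
    = diff (monom k mu gen_deg u) * monom k mu gen_deg v
      + parity_sign k mu (word_deg gen_deg u)
        *: (monom k mu gen_deg u * diff (monom k mu gen_deg v));
  action_gt0 : forall i, 0 < action i;
  action_diff : forall i (w : {fmonom 'I_ngen}),
    appears w (diff (monom k mu gen_deg (fmu i))) ->
    \sum_(j <- (w : seq 'I_ngen)) action j < action i
}.

Section DGANotions.
Variables (R : realType) (k : fieldType) (mu : int) (A : superDGA R k mu).

Definition dga_alg : algType k := superalg k mu (@gen_deg _ _ _ A).

Definition acyclic : Prop :=
  forall x : dga_alg, diff A x = 0 -> exists y : dga_alg, x = diff A y.

(* A field extension F of k is given by a morphism iota, and iota \; *%R is
   the action of k on F by multiplication through iota. *)
Definition augmentation (F : fieldType) (iota : {rmorphism k -> F})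
    (eps : {lrmorphism dga_alg -> F | iota \; *%R}) : Prop :=
  forall x : dga_alg, eps (diff A x) = 0.

End DGANotions.

(* Main.v *)
(* If A is not acyclic, then 1 is not a boundary: d e = 1 gives d (e x) = x for
   every cycle x. It then suffices to find a proper ideal containing all
   boundaries modulo which A is commutative, since the residue field at a maximal
   ideal above it is an augmentation.

   In characteristic 2 this is the ideal generated by the boundaries: if
   1 = sum x_i d(y_i), then squaring gives 1 = d (sum x_i^2 y_i d(y_i)).

   In the Z/2-graded case it is im d + J, with J the ideal generated by the odd
   generators. This is an ideal by the Leibniz rule, and if 1 = d e + j with j in
   J, then j is nilpotent, so that the cycle d e = 1 - j is invertible and
   1 = d (e (1 - j)^-1). *)

Require Import Defs.
From HB Require Import structures.
From mathcomp Require Import all_boot all_order all_algebra.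
From mathcomp Require Import boolp classical_sets reals.
From mathcomp.multinomials Require Import monalg.

Set Implicit Arguments.
Unset Strict Implicit.
Unset Printing Implicit Defensive.

Import GRing.Theory.
Local Open Scope ring_scope.

(** * The residue field of a maximal left ideal containing all commutators *)

Section FieldQuotient.
Local Open Scope quotient_scope.
Variables (R : nzRingType) (M : {pred R}).
Hypotheses (M_zmod : zmod_closed M)
  (M_mull : forall r m, m \in M -> r * m \in M)
  (M_comm : forall x y, x * y - y * x \in M)
  (M_proper : 1 \notin M)
  (M_max : forall x, x \notin M -> exists y, y * x - 1 \in M).

HB.instance Definition _ := GRing.isZmodClosed.Build R M M_zmod.

Definition field_quot : Type := Quotient.quot M.
HB.instance Definition _ := Choice.on field_quot.
HB.instance Definition _ := EqQuotient.on field_quot.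
HB.instance Definition _ := GRing.Zmodule.on field_quot.

Local Notation pi := (\pi_field_quot).

Let pi_eq x y : (pi x == pi y) = (x - y \in M).
Proof. by rewrite -Quotient.idealrBE. Qed.

Let piD : {morph pi : x y / x + y}.
Proof. exact: (@pi_addr _ _ _ _ _ (Quotient.quot M)). Qed.

Let pi0 : pi 0 = 0.
Proof. exact: (@pi_zeror _ _ _ _ _ (Quotient.quot M)). Qed.

(** Since [m * r - r * m] lies in [M], the left ideal [M] is two-sided. *)
Let M_mulr r m : m \in M -> m * r \in M.
Proof. by move=> Mm; rewrite -(subrK (r * m) (m * r)) rpredD ?M_mull. Qed.

Definition field_quot_mul : field_quot -> field_quot -> field_quot :=
  lift_op2 field_quot *%R.

Let piM x y : pi (x * y) = field_quot_mul (pi x) (pi y).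
Proof.
unlock field_quot_mul; apply/eqP; rewrite pi_eq.
set x' := repr (pi x); set y' := repr (pi y).
have -> : x * y - x' * y' = (x - x') * y + x' * (y - y').
  by rewrite mulrBl mulrBr addrA subrK.
by apply: rpredD; [apply: M_mulr|apply: M_mull]; rewrite -pi_eq reprK.
Qed.

Fact field_quot_mulA : associative field_quot_mul.
Proof.
by move=> x y z; rewrite -[x]reprK -[y]reprK -[z]reprK -!piM mulrA.
Qed.

Fact field_quot_mulC : commutative field_quot_mul.
Proof.
move=> x y; rewrite -[x]reprK -[y]reprK -!piM; apply/eqP.
by rewrite pi_eq M_comm.
Qed.

Fact field_quot_mul1 : left_id (pi 1) field_quot_mul.
Proof. by move=> x; rewrite -[x]reprK -piM mul1r. Qed.

Fact field_quot_mulDl : left_distributive field_quot_mul +%R.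
Proof.
move=> x y z; rewrite -[x]reprK -[y]reprK -[z]reprK.
by rewrite -piD -!piM -piD mulrDl.
Qed.

Fact field_quot_one_neq0 : pi 1 != 0.
Proof. by rewrite -pi0 pi_eq subr0. Qed.

HB.instance Definition _ := GRing.Zmodule_isComNzRing.Build field_quot
  field_quot_mulA field_quot_mulC field_quot_mul1 field_quot_mulDl
  field_quot_one_neq0.

(** Maximality supplies the inverse away from zero; at zero the value follows the convention that a
    field inverts 0 to 0. *)
Let field_quot_inv_ex (x : field_quot) :
  exists y, (x != 0 -> y * x = 1) /\ (x = 0 -> y = 0).
Proof.
have [->|x0] := eqVneq x 0; first by exists 0.
have /M_max[y My] : repr x \notin M.
  by apply: contraNN x0 => Mx; rewrite -[x]reprK -pi0 pi_eq subr0.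
exists (pi y); split=> [_|x_eq0]; last by rewrite x_eq0 eqxx in x0.
rewrite -[x in _ * x]reprK -[LHS]/(field_quot_mul _ _) -piM.
by apply/eqP; rewrite pi_eq.
Qed.

Definition field_quot_inv (x : field_quot) : field_quot :=
  projT1 (cid (field_quot_inv_ex x)).

Fact field_quot_mulV (x : field_quot) : x != 0 -> field_quot_inv x * x = 1.
Proof. by rewrite /field_quot_inv; case: cid => y /= []. Qed.

Fact field_quot_inv0 : field_quot_inv 0 = 0.
Proof. by rewrite /field_quot_inv; case: cid => y /= [_ ->]. Qed.

HB.instance Definition _ := GRing.ComNzRing_isField.Build field_quot
  field_quot_mulV field_quot_inv0.

Lemma maximal_ideal_residue_field :
  exists (F : fieldType) (f : {rmorphism R -> F}), forall x, x \in M -> f x = 0.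
Proof.
have pi_zmod : zmod_morphism (pi : R -> field_quot).
  by move=> x y; apply/(addIr (pi y)); rewrite subrK -piD subrK.
have pi_monoid : monoid_morphism (pi : R -> field_quot) by split=> //; exact: piM.
pose mZ := GRing.isZmodMorphism.Build R field_quot _ pi_zmod.
pose mM := GRing.isMonoidMorphism.Build R field_quot _ pi_monoid.
pose f : {rmorphism R -> field_quot} := HB.pack pi mZ mM.
exists field_quot, f => x Mx; rewrite -[LHS]/(pi x); apply/eqP.
by rewrite -pi0 pi_eq subr0.
Qed.

End FieldQuotient.

(** * Zorn's lemma: a maximal proper ideal above a given one *)

Section ResidueField.
Variables (R : nzRingType) (I : R -> Prop).
Hypotheses (I0 : I 0) (ID : forall x y, I x -> I y -> I (x + y))
  (Il : forall r x, I x -> I (r * x)) (IC : forall x y, I (x * y - y * x))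
  (I1 : ~ I 1).
Local Open Scope classical_set_scope.

Lemma residue_field_of_proper_ideal :
  exists (F : fieldType) (f : {rmorphism R -> F}), forall x, I x -> f x = 0.
Proof.
pose U (X : set R) : set R := [set x | I x \/ X x].
(* Working with [I `|` X] rather than [X] makes the empty chain harmless. *)
pose P (X : set R) :=
  [/\ forall x y, U X x -> U X y -> U X (x + y),
      forall r x, U X x -> U X (r * x) & ~ U X 1].
have [C CP Ctot|X [[XD Xl X1] Xmax]] := @Zorn_bigcup R P.
  (* Unless both lie in [I], totality of the chain puts two elements of the union into one member,
     where closure is known. *)
  have common x y : U (\bigcup_(X in C) X) x -> U (\bigcup_(X in C) X) y ->
      (I x /\ I y) \/ exists2 X, C X & U X x /\ U X y.
    move=> [Ix|[X CX Xx]] [Iy|[Y CY Yy]]; first by left.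
    - by right; exists Y => //; split; [left|right].
    - by right; exists X => //; split; [right|left].
    - by right; case: (Ctot _ _ CX CY) => sXY; [exists Y|exists X] => //;
        split; right => //; exact: sXY.
  have sub X : C X -> U X `<=` U (\bigcup_(X in C) X).
    by move=> CX x [|Xx]; [left|right; exists X].
  split=> [x y Ux Uy|r x Ux|U1].
  - have [[Ix Iy]|[X CX [Xx Xy]]] := common _ _ Ux Uy; first by left; exact: ID.
    by have [+ _ _] := CP _ CX => /(_ _ _ Xx Xy) /(sub _ CX).
  - have [[Ix _]|[X CX [Xx _]]] := common _ _ Ux Ux; first by left; exact: Il.
    by have [_ + _] := CP _ CX => /(_ r _ Xx) /(sub _ CX).
  - have [[/I1]|[X CX [X1 _]]] // := common _ _ U1 U1.
    by have [_ _ /(_ X1)] := CP _ CX.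
pose M : {pred R} := fun x => `[< U X x >].
have MP x : reflect (U X x) (x \in M) by exact: asboolP.
have [|||||F [f fM]] := @maximal_ideal_residue_field R M.
- split=> [|x y /MP Xx /MP Xy]; apply/MP; first by left.
  by apply: XD => //; rewrite -mulN1r; apply: Xl.
- by move=> r m /MP Xm; apply/MP/Xl.
- by move=> x y; apply/MP; left.
- exact/MP.
(* [Y] is the left ideal [M + R x]; if it missed 1, it would contradict the maximality of [X]. *)
- move=> x /MP Xx; pose Y : set R := [set z | exists r, U X (z - r * x)].
  have [r Yr] : Y 1.
    apply: contrapT => Y1; apply: (Xmax Y).
      split=> [z Xz|/(_ x) YX]; first by exists 0; rewrite mul0r subr0; right.
      by apply: Xx; right; apply: YX; exists 1; rewrite mul1r subrr; left.
    have UY z : U Y z -> Y z.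
      by case=> // Iz; exists 0; rewrite mul0r subr0; left.
    split=> [y z /UY[r Yr] /UY[s Ys]|s y /UY[r Yr]|/UY //]; right.
      by exists (r + s); rewrite mulrDl opprD addrACA; apply: XD.
    by exists (s * r); rewrite -mulrA -mulrBr; apply: Xl.
  by exists r; apply/MP; rewrite -opprB -mulN1r; apply: Xl.
- by exists F, f => x Ix; apply/fM/MP; left.
Qed.

End ResidueField.

(** * Monomials and their linear spans in the super-commutative algebra *)

Section Superalg.
Variables (k : fieldType) (mu : int) (n : nat) (deg : 'I_n -> int).
Implicit Types (u v w : {fmonom 'I_n}) (P Q S : {fmonom 'I_n} -> Prop).

Local Notation A := (superalg k mu deg).
Local Notation pi := (\pi_A)%qT.
Local Notation M := (monom k mu deg).

Lemma monomM u v : M u * M v = M (mmul u v).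
Proof.
rewrite -[LHS]/(superalg_mul (M u) (M v)) -pi_mulE; congr (pi _).
by rewrite -[LHS]/(fgmul _ _) fgmulUU mulr1.
Qed.

Lemma free_homogU w : @free_homog k mu n deg (word_deg deg w) << w >>.
Proof.
by move=> v; rewrite mcoeffU1; have [->|] := eqVneq w v; rewrite ?eqxx.
Qed.

Lemma monom_homog w : homog (word_deg deg w) (M w).
Proof. by exists << w >> => //; apply: free_homogU. Qed.

Lemma monom_supercomm u v :
  M u * M v = koszul k mu (word_deg deg u) (word_deg deg v) *: (M v * M u).
Proof.
rewrite -[M u * M v]/(superalg_mul (M u) (M v)).
rewrite -[M v * M u]/(superalg_mul (M v) (M u)).
rewrite -[_ *: superalg_mul _ _]/(superalg_scale _ _) -!pi_mulE -pi_scaleE.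
apply/eqP; rewrite pi_eq; apply/supercomm_idealP/two_sided_gen_base.
exists (word_deg deg u), (word_deg deg v), << u >>, << v >>.
by split=> //; apply: free_homogU.
Qed.

(** The [k]-span of a family of monomials. The inductive form avoids choosing a basis and lets
    linear claims be checked one monomial at a time. *)
Inductive mspan P : A -> Prop :=
| mspan0 : mspan P 0
| mspanDZ c w x of P w & mspan P x : mspan P (c *: M w + x).

Lemma mspan_monom P w : P w -> mspan P (M w).
Proof.
move=> Pw; rewrite -[M w]addr0 -[M w]scale1r.
by apply: mspanDZ => //; apply: mspan0.
Qed.

Lemma mspanD P x y : mspan P x -> mspan P y -> mspan P (x + y).
Proof.
move=> Px Py; elim: Px => [|c w z Pw _ IH]; first by rewrite add0r.
by rewrite -addrA; apply: mspanDZ.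
Qed.

Lemma mspanZ P c x : mspan P x -> mspan P (c *: x).
Proof.
elim=> [|d w y Pw _ IH]; first by rewrite scaler0; apply: mspan0.
by rewrite scalerDr scalerA; apply: mspanDZ.
Qed.

Lemma mspanM P Q S x y : (forall u v, P u -> Q v -> S (mmul u v)) ->
  mspan P x -> mspan Q y -> mspan S (x * y).
Proof.
move=> PQS Px Qy; elim: Px => [|c u x' Pu _ IHx].
  by rewrite mul0r; apply: mspan0.
rewrite mulrDl -scalerAl; apply: mspanD => //; apply: mspanZ => {x' x IHx}.
elim: Qy => [|d v y' Qv _ IHy]; first by rewrite mulr0; apply: mspan0.
by rewrite mulrDr -scalerAr monomM; apply: mspanDZ => //; apply: PQS.
Qed.

Lemma mspan_sub P Q x : (forall w, P w -> Q w) -> mspan P x -> mspan Q x.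
Proof.
move=> PQ; elim=> [|c w y /PQ Qw _ IH]; first exact: mspan0.
exact: mspanDZ.
Qed.

Lemma mspan_pi P (p : freealg k n) :
  (forall w, p@_w != 0 -> P w) -> mspan P (pi p).
Proof.
have mZ c w : << c *g w >> = c *: << w >> :> freealg k n.
  by apply/malgP=> v; rewrite mcoeffZ !mcoeffU mulr_natr.
move=> Pp; rewrite [p]monalgE big_seq.
elim/big_ind: _ => [|x y|w].
- have -> : pi 0 = 0 by exact: (@pi_zeror _ _ _ _ _ (Quotient.quot _)).
  exact: mspan0.
- by rewrite pi_addE; apply: mspanD.
- rewrite -mcoeff_neq0 => /Pp Pw; rewrite mZ pi_scaleE.
  exact/mspanZ/mspan_monom.
Qed.

Lemma mspanT x : mspan xpredT x.
Proof. by rewrite -[x]reprK; apply: mspan_pi. Qed.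

Lemma mspan_homog d x : homog d x ->
  mspan (fun w => (word_deg deg w = d %[mod mu])%Z) x.
Proof. by case=> p ->; apply: mspan_pi. Qed.

End Superalg.

(** * The Leibniz rule beyond monomials, and augmentations from ideals *)

Section DGA.
Variables (R : realType) (k : fieldType) (mu : int) (A : superDGA R k mu).
Implicit Types x y e : dga_alg A.

Local Notation M := (monom k mu (@gen_deg _ _ _ A)).
Local Notation sgn w := (parity_sign k mu (word_deg (@gen_deg _ _ _ A) w)).

Lemma diff1 : diff A 1 = 0.
Proof. by rewrite -[1](scale1r 1) diff_scalar. Qed.

(** Linearity extends the Leibniz rule in the second factor; the first stays a monomial because the
    sign depends on its degree. *)
Lemma diff_monom_mul w x :
  diff A (M w * x) = diff A (M w) * x + sgn w *: (M w * diff A x).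
Proof.
elim: (mspanT x) => [|c v y _ _ IH].
  by rewrite mulr0 linear0 !mulr0 scaler0 addr0.
rewrite mulrDr -scalerAr linearP IH diff_leibniz linearP !mulrDr !scalerDr.
by rewrite -!scalerAr !scalerA [c * _]mulrC addrACA.
Qed.

(** Every signed term carries the factor [diff A y], which vanishes, so [x] may be inhomogeneous. *)
Lemma diff_mul_closed x y : diff A y = 0 -> diff A (x * y) = diff A x * y.
Proof.
move=> y0; elim: (mspanT x) => [|c w z _ _ IH].
  by rewrite mul0r linear0 mul0r.
rewrite mulrDl -scalerAl !linearP IH mulrDl -scalerAl diff_monom_mul y0.
by rewrite mulr0 scaler0 addr0.
Qed.

Lemma exact_one_acyclic e : diff A e = 1 -> acyclic A.
Proof. by move=> e1 x x0; exists (e * x); rewrite diff_mul_closed ?e1 ?mul1r. Qed.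

Lemma augmentation_of_ideal (I : dga_alg A -> Prop) :
    I 0 -> (forall x y, I x -> I y -> I (x + y)) ->
    (forall x y, I y -> I (x * y)) -> (forall x y, I (x * y - y * x)) ->
    ~ I 1 -> (forall x, I (diff A x)) ->
  exists (F : fieldType) (iota : {rmorphism k -> F})
    (eps : {lrmorphism dga_alg A -> F | iota \; *%R}), augmentation eps.
Proof.
move=> I0 ID Il IC I1 Idiff.
have [F [f fI]] := residue_field_of_proper_ideal I0 ID Il IC I1.
(* The residue field extends [k] through the scalars of the algebra, which makes [f] linear over
   [k]. *)
pose iota : {rmorphism k -> F} := f \o in_alg (dga_alg A).
have f_scal : scalable_for (iota \; *%R) f.
  by move=> c x; rewrite -[X in c *: X]mul1r scalerAl rmorphM.
pose f_lin := GRing.isScalable.Build k (dga_alg A) F (iota \; *%R) f f_scal.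
pose eps : {lrmorphism dga_alg A -> F | iota \; *%R} := HB.pack (f : _ -> _) f f_lin.
by exists F, iota, eps => x; apply/fI/Idiff.
Qed.

End DGA.

(** * Characteristic two: the ideal generated by the boundaries *)

Section CharTwo.
Variables (R : realType) (k : fieldType) (mu : int) (A : superDGA R k mu).
Hypothesis char2 : 2%N \in [pchar k].
Implicit Types x y : dga_alg A.

Lemma pchar2_sign (d : int) : (-1) ^ d = 1 :> k.
Proof. by rewrite oppr_pchar2 // exp1rz. Qed.

Lemma pchar2_mulC x y : x * y = y * x.
Proof.
elim: (mspanT x) => [|c u x' _ _ IHx]; first by rewrite mul0r mulr0.
rewrite mulrDl mulrDr IHx -scalerAl -scalerAr; congr (_ *: _ + _).
elim: (mspanT y) => [|d v y' _ _ IHy]; first by rewrite mul0r mulr0.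
rewrite mulrDl mulrDr IHy -scalerAl -scalerAr; congr (_ *: _ + _).
by rewrite monom_supercomm /koszul pchar2_sign scale1r.
Qed.

Lemma pchar2_addrr x : x + x = 0.
Proof. by rewrite -mulr2n -scaler_nat (pcharf0 char2) scale0r. Qed.

Lemma pchar2_leibniz x y : diff A (x * y) = diff A x * y + x * diff A y.
Proof.
elim: (mspanT x) => [|c w z _ _ IH]; first by rewrite !(mul0r, linear0) addr0.
rewrite mulrDl -scalerAl !linearP IH diff_monom_mul /parity_sign pchar2_sign.
by rewrite scale1r !mulrDl scalerDr -!scalerAl addrACA.
Qed.

(* Frobenius: a sum of multiples of boundaries [x_i * d y_i] has square
   [d (sum x_i ^ 2 * (y_i * d y_i))]. *)
Lemma pchar2_boundary_ideal_sqr x :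
  two_sided_gen (fun z => exists y, z = diff A y) x ->
  exists y, x * x = diff A y.
Proof.
have sqM y z : y * z * (y * z) = y * y * (z * z).
  by rewrite mulrA -(mulrA y z y) (pchar2_mulC z y) !mulrA.
(* All squares are cycles, because the Leibniz rule gives [2 y d y]. *)
have sqC y : diff A (y * y) = 0.
  by rewrite pchar2_leibniz (pchar2_mulC (diff A y)) pchar2_addrr.
elim=> {x} [_ [y ->]||x y _ [x' Ex] _ [y' Ey]|x y _ [y' Ey]|x y _ [x' Ex]].
- by exists (y * diff A y); rewrite diff_mul_closed ?diff_square.
- by exists 0; rewrite mulr0 linear0.
(* The two cross terms are equal, hence cancel. *)
- exists (x' + y'); rewrite linearD -Ex -Ey mulrDl !mulrDr (pchar2_mulC y x).
  by rewrite addrACA addrA -(addrA (x * x)) pchar2_addrr addr0.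
(* The square of the cofactor is a cycle, so it passes through the differential. *)
- by exists (y' * (x * x)); rewrite sqM diff_mul_closed // -Ey pchar2_mulC.
- by exists (x' * (y * y)); rewrite sqM diff_mul_closed // -Ex.
Qed.

Lemma pchar2_augmentation : ~ acyclic A ->
  exists (F : fieldType) (iota : {rmorphism k -> F})
    (eps : {lrmorphism dga_alg A -> F | iota \; *%R}), augmentation eps.
Proof.
move=> nacyc; pose I := two_sided_gen (fun z => exists y, z = diff A y).
apply: (@augmentation_of_ideal _ _ _ A I).
- exact: two_sided_gen0.
- exact: two_sided_genD.
- exact: two_sided_genMl.
- by move=> x y; rewrite pchar2_mulC subrr; apply: two_sided_gen0.
- move=> /pchar2_boundary_ideal_sqr[y]; rewrite mulr1 => /esym.
  by move=> /exact_one_acyclic.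
- by move=> x; apply: two_sided_gen_base; exists x.
Qed.

End CharTwo.

(** * Characteristic not two: filtration by the number of odd generators *)

Section CharNotTwo.
Variables (k : fieldType) (n : nat) (deg : 'I_n -> int).
Hypothesis charN2 : 2%N \notin [pchar k].
Implicit Types u v w : {fmonom 'I_n}.

Local Notation M := (monom k 2 deg).

Definition odd_gen : pred 'I_n := fun i => ~~ (2 %| deg i)%Z.

Lemma koszul_odd (d e : int) :
  (d = 1 %[mod 2])%Z -> (e = 1 %[mod 2])%Z -> koszul k 2 d e = -1.
Proof. by rewrite /koszul => -> ->. Qed.

Lemma modz2P (d : int) : (d = 0 %[mod 2])%Z \/ (d = 1 %[mod 2])%Z.
Proof.
have := ltz_mod d (isT : 2 != 0 :> int); have := modz_ge0 d (isT : 2 != 0 :> int).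
by case: (d %% 2)%Z => [[|[|]]|] //; [left|right].
Qed.

(** A sum of even degrees is even. *)
Lemma odd_word_has_odd_gen w :
  (word_deg deg w = 1 %[mod 2])%Z -> (0 < count odd_gen w)%N.
Proof.
apply: contra_eqT; rewrite -has_count -all_predC => /allP ev.
suff /dvdz_mod0P -> : (2 %| word_deg deg w)%Z by [].
rewrite /word_deg big_seq; apply: rpred_sum => i /ev.
by rewrite /= negbK.
Qed.

(** Super-commuting an odd generator with itself makes its square equal to its own opposite, and 2
    is invertible. *)
Lemma odd_gen_sqr0 i : odd_gen i -> M (fmu i) * M (fmu i) = 0.
Proof.
move=> oi; have di : (word_deg deg (fmu i) = 1 %[mod 2])%Z.
  have [|//] := modz2P (word_deg deg (fmu i)).
  rewrite /word_deg fmuE /= big_seq1 mod0z => /dvdz_mod0P di.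
  by rewrite /odd_gen di in oi.
have N0 (x : superalg k 2 deg) : x = - x -> x = 0.
  move=> xN; have /eqP : x + x = 0 by rewrite {1}xN addNr.
  rewrite -mulr2n -scaler_nat scaler_eq0.
  by move: charN2; rewrite inE /= => /negPf -> /eqP.
apply: N0; have := monom_supercomm k 2 deg (fmu i) (fmu i).
by rewrite koszul_odd // scaleN1r.
Qed.

(** Moving one copy of the repeated generator past the letters in between costs only a scalar and
    produces its square. *)
Lemma word_repeat_odd0 w : ~~ uniq (filter odd_gen w) -> M w = 0.
Proof.
case: w => s; pose m s := M (FMonom s); rewrite -[M _]/(m s) /=.
have m_cat s1 s2 : m (s1 ++ s2) = m s1 * m s2.
  by rewrite monomM; congr M; apply/val_inj; rewrite /= fmM.
have sandwich0 i t : odd_gen i -> m [:: i] * m t * m [:: i] = 0.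
  have -> : m [:: i] = M (fmu i) by rewrite /m fmuE.
  move=> oi; rewrite -mulrA (monom_supercomm k 2 deg (FMonom t)) -scalerAr.
  by rewrite mulrA odd_gen_sqr0 // mul0r scaler0.
elim: s => //= i s IH; rewrite -[i :: s]cat1s m_cat.
case: ifPn => [oi|_ /IH->]; last by rewrite mulr0.
rewrite /= negb_and negbK => /orP[|/IH->]; last by rewrite mulr0.
rewrite mem_filter oi => /splitPr[a b]; rewrite m_cat -(cat1s i b) m_cat.
by rewrite !mulrA sandwich0 ?mul0r.
Qed.

(* [oddfil 1] is the ideal generated by the odd generators. *)
Definition oddfil j := mspan (k := k) (mu := 2) (deg := deg)
  (fun w => (j <= count odd_gen w)%N).

Lemma oddfilM i j x y : oddfil i x -> oddfil j y -> oddfil (i + j) (x * y).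
Proof.
by apply: mspanM => u v ui vj; rewrite fmM count_cat leq_add.
Qed.

Lemma oddfil0 x : oddfil 0 x.
Proof. exact: mspan_sub (mspanT x). Qed.

(** Pigeonhole: among [n] generators, [n.+1] odd letters must repeat one. *)
Lemma oddfil_eq0 x : oddfil n.+1 x -> x = 0.
Proof.
elim=> // c w y wn _ ->; rewrite word_repeat_odd0 ?scaler0 ?addr0 //.
apply: contraL wn; rewrite -leqNgt -size_filter => /card_uniqP <-.
by rewrite -[leqRHS](card_ord n) max_card.
Qed.

Lemma oddfil_nilpotent x : oddfil 1 x -> x ^+ n.+1 = 0.
Proof.
move=> x1; apply: oddfil_eq0; elim: (n.+1) => [|j IH]; first exact: oddfil0.
by rewrite exprS -add1n; apply: oddfilM.
Qed.

Lemma odd_oddfil w : (word_deg deg w = 1 %[mod 2])%Z -> oddfil 1 (M w).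
Proof. by move=> /odd_word_has_odd_gen ?; apply: mspan_monom. Qed.

(** An even monomial is central; for an odd one, both products already lie in the ideal. *)
Lemma comm_mod_oddfil (x y : superalg k 2 deg) : oddfil 1 (x * y - y * x).
Proof.
have sub0 : oddfil 1 (0 : superalg k 2 deg) by apply: mspan0.
elim: (mspanT x) => [|c u x' _ _ IHx]; first by rewrite mul0r mulr0 subrr.
rewrite mulrDl mulrDr opprD addrACA; apply: mspanD => //.
rewrite -scalerAl -scalerAr -scalerBr; apply: mspanZ.
elim: (mspanT y) => [|d v y' _ _ IHy]; first by rewrite mul0r mulr0 subrr.
rewrite mulrDl mulrDr opprD addrACA; apply: mspanD => //.
rewrite -scalerAl -scalerAr -scalerBr; apply: mspanZ.
have [du|/odd_oddfil u1] := modz2P (word_deg deg u).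
  by rewrite monom_supercomm /koszul du mod0z mul0r expr0z scale1r subrr.
apply: mspanD; first exact: (oddfilM u1 (oddfil0 _)).
by rewrite -scaleN1r; apply: mspanZ; exact: (oddfilM (oddfil0 _) u1).
Qed.

End CharNotTwo.

(** * The Z/2-graded case: boundaries modulo the odd ideal *)

Section Z2Graded.
Variables (R : realType) (k : fieldType) (A : superDGA R k 2).
Hypothesis charN2 : 2%N \notin [pchar k].
Implicit Types x y : dga_alg A.

Local Notation J := (@oddfil k (ngen A) (@gen_deg _ _ _ A) 1).
Local Notation M := (monom k 2 (@gen_deg _ _ _ A)).

Definition boundary_mod_odd x := exists e j, J j /\ x = diff A e + j.

Lemma boundary_mod_odd0 : boundary_mod_odd 0.
Proof. by exists 0, 0; split; [apply: mspan0 | rewrite linear0 addr0]. Qed.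

Lemma boundary_mod_oddD x y :
  boundary_mod_odd x -> boundary_mod_odd y -> boundary_mod_odd (x + y).
Proof.
move=> [e [j [Jj ->]]] [f [l [Jl ->]]]; exists (e + f), (j + l).
by split; [apply: mspanD | rewrite linearD addrACA].
Qed.

Lemma boundary_mod_oddZ c x : boundary_mod_odd x -> boundary_mod_odd (c *: x).
Proof.
move=> [e [j [Jj ->]]]; exists (c *: e), (c *: j).
by split; [apply: mspanZ | rewrite linearZ scalerDr].
Qed.

Lemma boundary_mod_odd_odd x : J x -> boundary_mod_odd x.
Proof. by exists 0, x; rewrite linear0 add0r. Qed.

(* For [x] even and [y] odd, [x * d y = d (x * y) - d x * y] where [d x * y] is a
   multiple of an odd element; for other parities [x] or [d y] is odd. *)
Lemma boundary_mod_oddMl x y :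
  boundary_mod_odd y -> boundary_mod_odd (x * y).
Proof.
move=> [e [j [Jj ->]]]; rewrite mulrDr; apply: boundary_mod_oddD; last first.
  exact/boundary_mod_odd_odd/(oddfilM (oddfil0 _) Jj).
elim: (mspanT x) => [|c u x' _ _ IHx].
  by rewrite mul0r; apply: boundary_mod_odd0.
rewrite mulrDl -scalerAl; apply: boundary_mod_oddD => //.
apply: boundary_mod_oddZ; elim: (mspanT e) => [|d v e' _ _ IHe].
  by rewrite linear0 mulr0; apply: boundary_mod_odd0.
rewrite linearP mulrDr -scalerAr; apply: boundary_mod_oddD => //.
apply: boundary_mod_oddZ.
have [du|/(odd_oddfil k) Ju] := modz2P (word_deg (@gen_deg _ _ _ A) u); last first.
  exact/boundary_mod_odd_odd/(oddfilM Ju (oddfil0 _)).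
have [dv|/(odd_oddfil k) Jv] := modz2P (word_deg (@gen_deg _ _ _ A) v).
  (* For [v] even, [diff A (M v)] is homogeneous of odd degree, so each of its words has an odd
     generator. *)
  apply/boundary_mod_odd_odd/(oddfilM (oddfil0 _) (_ : J _)).
  apply: mspan_sub (mspan_homog (diff_homog (monom_homog k 2 _ v))) => w dw.
  by apply: odd_word_has_odd_gen; rewrite dw -modzDml dv.
exists (M u * M v), (- (diff A (M u) * M v)); split.
  by rewrite -scaleN1r; apply: mspanZ; exact: (oddfilM (oddfil0 _) Jv).
by rewrite diff_leibniz /parity_sign du mod0z expr0z scale1r addrC addKr.
Qed.

(* If [d e = 1 - j] with [j] in the ideal of odd elements, then [1 - j] is a
   cycle with inverse [v] a finite geometric series; [v] is a cycle too, so
   [d (e * v) = 1]. *)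
Lemma boundary_mod_odd1 : boundary_mod_odd 1 -> acyclic A.
Proof.
move=> [e [j [Jj /eqP]]]; rewrite -subr_eq => /eqP w_def.
set w := 1 - j in w_def; pose v : dga_alg A := \sum_(i < (ngen A).+1) j ^+ i.
(* The series stops at the nilpotency exponent of [j], so it telescopes to exactly 1. *)
have jn : 1 - j ^+ (ngen A).+1 = 1 by rewrite (oddfil_nilpotent charN2 Jj) subr0.
have wv : w * v = 1 by rewrite -jn -opprB subrX1 -mulNr opprB.
have vw : v * w = 1.
  rewrite -[RHS]wv; apply/esym/commr_sum => i _; apply: commrX.
  exact/commr_sym/commrB/commr_refl/commr1.
(* Differentiating [v * w = 1] gives [diff A v * w = 0]; multiplying by [v] on the right removes
   [w]. *)
have v0 : diff A v = 0.
  have := diff_mul_closed v (_ : diff A w = 0).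
  rewrite vw diff1 w_def diff_square => /(_ erefl)/(congr1 ( *%R^~ v)).
  by rewrite mul0r -mulrA -w_def wv mulr1.
apply: (@exact_one_acyclic _ _ _ _ (e * v)).
by rewrite diff_mul_closed // -w_def.
Qed.

Lemma Z2graded_augmentation : ~ acyclic A ->
  exists (F : fieldType) (iota : {rmorphism k -> F})
    (eps : {lrmorphism dga_alg A -> F | iota \; *%R}), augmentation eps.
Proof.
move=> nacyc; apply: (@augmentation_of_ideal _ _ _ A boundary_mod_odd).
- exact: boundary_mod_odd0.
- exact: boundary_mod_oddD.
- exact: boundary_mod_oddMl.
- by move=> x y; apply/boundary_mod_odd_odd/comm_mod_oddfil.
- by move/boundary_mod_odd1.
- by move=> x; exists x, 0; rewrite addr0; split=> //; apply: mspan0.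
Qed.

End Z2Graded.

Theorem corollary1p4 (R : realType) (k : fieldType) (mu : int)
    (A : superDGA R k mu)
    (hk : (2%N \notin [pchar k] /\ mu = 2) \/ 2%N \in [pchar k]) :
  (exists (F : fieldType) (iota : {rmorphism k -> F})
          (eps : {lrmorphism dga_alg A -> F | iota \; *%R}),
     augmentation eps)
  <-> ~ acyclic A.
Proof.
split=> [[F [iota [eps eps_diff]]] acyc|].
  (* The cycle 1 would be a boundary, and an augmentation would send it to both 0 and 1. *)
  have [y y1] := acyc 1 (diff1 A).
  by have /eqP := eps_diff y; rewrite -y1 rmorph1 oner_eq0.
case: hk => [[charN2 mu2]|char2]; last exact: pchar2_augmentation.
by subst mu; apply: Z2graded_augmentation.
Qed.
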